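(* Let $\mathcal{D}$ be a fixed universal randomness-type prediction system, and let $\Gamma$ be a conformal predictor based on a computable conformity measure taking values in $\mathbb{Q}$. Then there exists $c\in\mathbb{N}$ such that, for every probability measure $Q$ on $\mathbf{X}\times\mathbb{2}$, for $Q^\infty$-almost all infinite data sequences $\omega=((x_1,y_1),(x_2,y_2),\ldots)\in(\mathbf{X}\times\mathbb{2})^\infty$ and all significance levels $\epsilon\in(0,1)$, from some $l$ on we have $$\Pi_{\mathcal{D}_{\lfloor-\log\epsilon\rfloor-c}}((\omega^{l-1},x_l))\subseteq\Gamma^\epsilon((\omega^{l-1},x_l)).$$
   Context: $\log$ is binary logarithm. $\mathbf{X}$ is a fixed finite set of binary strings, $\mathbb{2}:=\{0,1\}$, $\mathbb{N}=\{1,2,\ldots\}$, $\mathbb{N}_0=\{0,1,2,\ldots\}$. For $\omega\in(\mathbf{X}\times\mathbb{2})^\infty$, $\omega^i$ is the prefix of $\omega$ of length $i$. A situation is a pair $s=(\sigma,x)$ with $\sigma\in(\mathbf{X}\times\mathbb{2})^*$ and $x\in\mathbf{X}$; for $y\in\mathbb{2}$, $(s,y)$ denotes the finite data sequence obtained by appending $(x,y)$ to $\sigma$. $Q^\infty$ is the infinite product measure (the observations $(x_i,y_i)$ are independent and identically distributed according to $Q$). A randomness-type prediction system is a family $\Lambda=(\Lambda_m)_{m\in\mathbb{N}_0}$ of sets $\Lambda_m\subseteq(\mathbf{X}\times\mathbb{2})^*$ that is jointly enumerable (the set $\{(\sigma,m)\mid\sigma\in\Lambda_m\}$ is recursively enumerable)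 and such that: (i) $\Lambda_0\supseteq\Lambda_1\supseteq\cdots$; (ii) for all $m\in\mathbb{N}_0$, $l\in\mathbb{N}$, and $\omega\in(\mathbf{X}\times\mathbb{2})^\infty$, $|\{i\in\{1,\ldots,l\}\mid\omega^i\in\Lambda_m\}|\le2^{-m}l$. A randomness-type prediction system $\mathcal{D}$ is universal if for any randomness-type prediction system $\Lambda$ there exists $c\in\mathbb{N}$ such that $\Lambda_{m+c}\subseteq\mathcal{D}_m$ for all $m\in\mathbb{N}_0$ (such $\mathcal{D}$ exist). Set $\mathcal{D}_m:=(\mathbf{X}\times\mathbb{2})^*$ for $m<0$ and, for any integer $m$ and situation $s$, $\Pi_{\mathcal{D}_m}(s):=\{y\in\mathbb{2}\mid(s,y)\notin\mathcal{D}_m\}$. A conformity measure (with values in $\mathbb{Q}$) is a function $A$ that maps every finite sequence $(z_1,\ldots,z_n)\in(\mathbf{X}\times\mathbb{2})^n$, $n\in\mathbb{N}$, to a sequence $(\alpha_1,\ldots,\alpha_n)\in\mathbb{Q}^n$ and is equivariant under permutations: if $A(z_1,\ldots,z_n)=(\alpha_1,\ldots,\alpha_n)$, then $A(z_{\pi(1)},\ldots,z_{\pi(n)})=(\alpha_{\pi(1)},\ldots,\alpha_{\pi(n)})$ for every permutation $\pi$ of $\{1,\ldots,n\}$. The conformal predictor $\Gamma$ based on $A$ outputs, in a situation $s=((z_1,\ldots,z_{n-1}),x)$ and at significance level $\epsilon\in(0,1)$, the set $\Gamma^\epsilon(s):=\{y\in\mathbb{2}\mid p^y>\epsilon\}$,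 where $p^y:=|\{i\in\{1,\ldots,n\}\mid\alpha^y_i\le\alpha^y_n\}|/n$ and $(\alpha^y_1,\ldots,\alpha^y_n):=A(z_1,\ldots,z_{n-1},(x,y))$. *)

(* Defs.v *)
From HB Require Import structures.
From mathcomp Require Import finmap.
From mathcomp Require Import all_boot all_order all_fingroup all_algebra.
From mathcomp Require Import all_classical all_reals all_analysis.

Set Implicit Arguments.
Unset Strict Implicit.
Unset Printing Implicit Defensive.

Import Order.TTheory GRing.Theory Num.Theory.

Local Open Scope classical_set_scope.
Local Open Scope nat_scope.

(* Total recursive functions in Kleene's sense: minimization is applied only
   when it yields a total function.  Every rule specifies the new function
   pointwise, so the class is closed under extensional equality. *)
Inductive recursive : forall k : nat, (k.-tuple nat -> nat) -> Prop :=
| recursive_zero k (g : k.-tuple nat -> nat) :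
    (forall v, g v = 0) -> recursive g
| recursive_succ (g : 1.-tuple nat -> nat) :
    (forall n, g [tuple n] = n.+1) -> recursive g
| recursive_proj k (i : 'I_k) (g : k.-tuple nat -> nat) :
    (forall v, g v = tnth v i) -> recursive g
| recursive_comp k m (f : m.-tuple nat -> nat) (h : 'I_m -> k.-tuple nat -> nat)
    (g : k.-tuple nat -> nat) :
    recursive f -> (forall i, recursive (h i)) ->
    (forall v, g v = f [tuple h i v | i < m]) -> recursive g
| recursive_prim k (f : k.-tuple nat -> nat) (h : k.+2.-tuple nat -> nat)
    (g : k.+1.-tuple nat -> nat) :
    recursive f -> recursive h ->
    (forall v : k.-tuple nat, g [tuple of 0 :: v] = f v) ->
    (forall n (v : k.-tuple nat), g [tuple of n.+1 :: v] =
       h [tuple of n :: g [tuple of n :: v] :: v]) ->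
    recursive g
| recursive_mu k (f : k.+1.-tuple nat -> nat) (g : k.-tuple nat -> nat) :
    recursive f ->
    (forall v : k.-tuple nat, f [tuple of g v :: v] = 0) ->
    (forall (v : k.-tuple nat) n, n < g v -> f [tuple of n :: v] <> 0) ->
    recursive g.

(* Finite objects are coded by [pickle], which on the types used here (finite
   types, nat, rat, and pairs and sequences of these) is an effective coding
   with decidable range, built from [CodeSeq.code]. *)
Definition recursively_enumerable (T : countType) (A : set T) : Prop :=
  A = set0 \/
  exists2 f : 1.-tuple nat -> nat, recursive f &
    pickle @` A = range (fun n => f [tuple n]).

(* An infinite sequence (z_1, z_2, ...) is the function w with w i = z_(i+1);
   its prefix of length l is [mkseq w l]. *)
Definition randomness_prediction_system (Z : finType)
    (L : nat -> set (seq Z)) : Prop :=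
  [/\ recursively_enumerable [set p : seq Z * nat | L p.2 p.1],
      forall m, L m.+1 `<=` L m &
      forall (m l : nat) (w : nat -> Z), 0 < l ->
        (#|[pred i : 'I_l | mkseq w i.+1 \in L m]|%:R
           <= 2%:R ^- m * l%:R :> rat)%R].

Definition universal_prediction_system (Z : finType)
    (D : nat -> set (seq Z)) : Prop :=
  randomness_prediction_system D /\
  forall L : nat -> set (seq Z), randomness_prediction_system L ->
    exists2 c : nat, 0 < c & forall m, L (m + c) `<=` D m.

Definition level (Z : Type) (D : nat -> set (seq Z)) (m : int) : set (seq Z) :=
  if m is Posz n then D n else setT.

Definition situation (X : Type) : Type := (seq (X * bool) * X)%type.

Definition extend (X : Type) (s : situation X) (y : bool) : seq (X * bool) :=
  rcons s.1 (s.2, y).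

Definition prediction_set (X : Type) (D : nat -> set (seq (X * bool)))
    (m : int) (s : situation X) : set bool :=
  [set y | ~ level D m (extend s y)].

(* The clause n = 0 is vacuous: there is only one map between 0-tuples. *)
Definition conformity_measure (Z : Type)
    (A : forall n, n.-tuple Z -> n.-tuple rat) : Prop :=
  forall n (p : 'S_n) (z : n.-tuple Z),
    A n [tuple tnth z (p i) | i < n] = [tuple tnth (A n z) (p i) | i < n].

Definition computable_measure (Z : countType)
    (A : forall n, n.-tuple Z -> n.-tuple rat) : Prop :=
  exists2 f : 1.-tuple nat -> nat, recursive f &
    forall n (z : n.-tuple Z),
      f [tuple pickle (tval z)] = pickle (tval (A n z)).

Section Conformal.
Variables (R : realType) (X : Type).
Variable A : forall n, n.-tuple (X * bool) -> n.-tuple rat.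

Definition p_value (s : situation X) (y : bool) : R :=
  let n := (size s.1).+1 in
  let alpha : n.-tuple rat := A [tuple of rcons (in_tuple s.1) (s.2, y)] in
  (#|[pred i : 'I_n | (tnth alpha i <= tnth alpha ord_max)%R]|%:R / n%:R)%R.

Definition conformal_predictor (eps : R) (s : situation X) : set bool :=
  [set y | (eps < p_value s y)%R].

End Conformal.

(* [outcome z0] is the finite type Z with its discrete sigma-algebra, and
   [sequences z0] is the type nat -> Z with the sigma-algebra generated by the
   cylinders.  The point z0 is recorded because measurable types are pointed in
   the library; it plays no other role. *)
Definition outcome (Z : finType) (z0 : Z) : Type := Z.

Section Outcome.
Variables (Z : finType) (z0 : Z).
HB.instance Definition _ := Finite.on (outcome z0).
HB.instance Definition _ := isPointed.Build (outcome z0) z0.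
HB.instance Definition _ := @isMeasurable.Build default_measure_display
  (outcome z0) discrete_measurable discrete_measurable0
  discrete_measurableC discrete_measurableU.
End Outcome.

Definition cylinder (Z : Type) (s : seq Z) : set (nat -> Z) :=
  [set w | mkseq w (size s) = s].

Definition sequences (Z : finType) (z0 : Z) :=
  g_sigma_algebraType (range (@cylinder (outcome z0))).

(* By the uniqueness of measures agreeing on a pi-system, at most one P satisfies
   this; it is the measure under which the coordinates are independent and
   distributed according to Q. *)
Definition is_infinite_product (R : realType) (Z : finType) (z0 : Z)
    (Q : probability (outcome z0) R) (P : probability (sequences z0) R) : Prop :=
  forall s : seq Z,
    P (cylinder s) = (\prod_(z <- s) Q [set z])%E.

(* Main.v *)
(* A conformal predictor with significance level 2^-(m+1) makes, in the long run,
   errors with frequency at most 2^-(m+1): for an exchangeable weight on sequences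
   of length n, the n-th conformal p-value is at most 2^-(m+1) with conditional
   probability at most 2^-(m+1) given the multiset of the first n data.  Hence the
   exponential moments of the number of errors are dominated by those of
   independent errors, the event that the frequency exceeds 2^-m has exponentially
   small probability, and by Borel-Cantelli it occurs only finitely often, almost
   surely.  Put in the m-th set the sequences whose last p-value is at most
   2^-(m+1), unless the frequency of errors along the sequence is too large; the
   last member of the set met along a data sequence then bounds the number of all
   earlier ones, so this is a randomness-type prediction system.  It is decidable
   because the conformity measure is computable, and universality of D concludes. *)

Require Import Defs.
From mathcomp Require Import finmap.
From mathcomp Require Import all_boot all_order all_fingroup all_algebra.
From mathcomp Require Import all_classical all_reals all_analysis.
From mathcomp Require Import ring lra.

Set Implicit Arguments.
Unset Strict Implicit.

Import Order.TTheory GRing.Theory Num.Theory.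
Local Open Scope classical_set_scope.
Local Open Scope nat_scope.

(** * Computability over lists of arguments *)

(* Environments are lists of arbitrary length, entries beyond the end reading
   as 0, so that one predicate covers all arities. *)
Definition computable (F : seq nat -> nat) : Prop :=
  forall k, recursive (fun v : k.-tuple nat => F (tval v)).

Lemma eq_computable F G : F =1 G -> computable F -> computable G.
Proof. by move=> FG; rewrite (_ : G = F) //; apply/funext => v. Qed.

Lemma mktuple_eq n (f : 'I_n -> nat) (s : seq nat) :
  size s = n -> (forall i : 'I_n, f i = nth 0 s i) ->
  [tuple f i | i < n] = s :> seq nat.
Proof.
move=> sz fE; apply: (@eq_from_nth _ 0) => [|i]; first by rewrite size_tuple.
rewrite size_tuple => i_n; rewrite -(fE (Ordinal i_n)).
by rewrite -[i]/(val (Ordinal i_n)) -tnth_nth tnth_mktuple.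
Qed.

Lemma computable_cst c : computable (fun=> c).
Proof.
move=> k; elim: c => [|c IHc]; first exact: recursive_zero.
apply: (@recursive_comp k 1 (fun v => (tnth v ord0).+1) (fun _ _ => c)) => // [|_].
  by apply: recursive_succ.
by rewrite tnth_mktuple.
Qed.

Lemma computable_nth i : computable (fun v => nth 0 v i).
Proof.
move=> k; have [ik|ki] := ltnP i k.
  by apply: (@recursive_proj k (Ordinal ik)) => v; rewrite (tnth_nth 0).
by apply: recursive_zero => v; rewrite nth_default ?size_tuple.
Qed.

Lemma computable_subst F (Gs : seq (seq nat -> nat)) :
  computable F -> (forall i, computable (nth (fun=> 0) Gs i)) ->
  computable (fun v => F [seq G v | G <- Gs]).
Proof.
move=> cF cG k.
apply: (@recursive_comp k (size Gs) _ (fun i v => nth (fun=> 0) Gs i v)).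
- exact: cF.
- by move=> i; apply: cG.
- move=> v; congr F; apply/esym/mktuple_eq => [|i]; first by rewrite size_map.
  by rewrite (nth_map (fun=> 0)).
Qed.

(** Weakening for environments: entry 0 plays the role of a bound variable and [behead] recovers the
    outer context. *)
Lemma computable_behead F :
  computable F -> computable (fun v => F (behead v)).
Proof.
move=> cF [|k].
  (* The empty environment is its own tail. *)
  rewrite (_ : (fun _ => _) = fun v : 0.-tuple nat => F v); first exact: cF.
  by apply/funext => v; rewrite tuple0.
apply: (@recursive_comp k.+1 k (fun v => F v)
          (fun (i : 'I_k) v => nth 0 (tval v) i.+1)).
- exact: cF.
- by move=> i; apply: computable_nth.
- move=> v; congr F; apply/esym/mktuple_eq => [|i].
    by rewrite size_behead size_tuple.
  by rewrite nth_behead.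
Qed.

(** Taking [d] = 0 pushes a computed value; a larger [d] also discards bound variables. *)
Lemma computable_cons d F G : computable F -> computable G ->
  computable (fun v => F (G v :: drop d v)).
Proof.
move=> cF cG k.
apply: (@recursive_comp k (k - d).+1 (fun v => F v)
  (fun (i : 'I_(k - d).+1) v =>
     if i == 0 :> nat then G v else nth 0 (tval v) (d + i.-1))).
- exact: cF.
- by case=> -[|i] ik /=; [apply: cG|apply: computable_nth].
- move=> v; congr F; apply/esym/mktuple_eq => [|[[|i] ik]] //=.
    by rewrite size_drop size_tuple.
  by rewrite nth_drop.
Qed.

Lemma computable_app1 f G : recursive f -> computable G ->
  computable (fun v => f [tuple G v]).
Proof.
move=> rf cG k; apply: (@recursive_comp k 1 f (fun _ v => G v)) => //.
by move=> v; congr f; apply: eq_from_tnth => i; rewrite tnth_map ord1.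
Qed.

(** Primitive recursion with the counter at entry 0 and the accumulator at entry 1. The recursion
    runs on the head of the environment, into which [N v] is pushed afterwards. *)
Lemma computable_iteri F B N :
  computable (fun v => F (nth 0 v 0) (nth 0 v 1) (behead (behead v))) ->
  computable B -> computable N ->
  computable (fun v => iteri (N v) (fun i a => F i a v) (B v)).
Proof.
move=> cF cB cN.
suff /(computable_cons 0)/(_ cN) : computable (fun v =>
    iteri (head 0 v) (fun i a => F i a (behead v)) (B (behead v))).
  by apply: eq_computable => v; rewrite drop0.
(* With no arguments the head reads as 0, so no iteration takes place. *)
move=> [|k].
  rewrite (_ : (fun _ => _) = fun v : 0.-tuple nat => B v); first exact: cB.
  by apply/funext => v; rewrite tuple0.
apply: (@recursive_prim k (fun v => B v) (fun v =>
  F (nth 0 (tval v) 0) (nth 0 (tval v) 1) (behead (behead (tval v))))) => //.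
Qed.

Lemma computable_mu F G : computable F ->
  (forall v, F (G v :: v) = 0) ->
  (forall v n, n < G v -> F (n :: v) <> 0) -> computable G.
Proof.
move=> cF F0 Gmin k; apply: (@recursive_mu k (fun v => F v)) => [|v|v n] //.
- exact: F0.
- exact: Gmin.
Qed.

Lemma computable_app2 (f : nat -> nat -> nat) G H :
  computable (fun v => f (nth 0 v 0) (nth 0 v 1)) ->
  computable G -> computable H -> computable (fun v => f (G v) (H v)).
Proof.
move=> cf cG cH; apply: (@computable_subst _ [:: G; H]) cf _.
by case=> [|[|i]] //=; rewrite nth_nil; apply: computable_cst.
Qed.

Lemma computable_comp1 (f : nat -> nat) G :
  computable (fun v => f (nth 0 v 0)) ->
  computable G -> computable (fun v => f (G v)).
Proof.
move=> cf cG; apply: (@computable_subst _ [:: G]) cf _.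
by case=> [|i] //=; rewrite nth_nil; apply: computable_cst.
Qed.

Lemma computableS G : computable G -> computable (fun v => (G v).+1).
Proof.
apply: computable_comp1 => k.
apply: (@recursive_comp k 1 (fun v => (tnth v ord0).+1)
          (fun _ v => nth 0 (tval v) 0)).
- exact: recursive_succ.
- by move=> _; apply: computable_nth.
- by move=> v; rewrite tnth_mktuple.
Qed.

Lemma computableD F G :
  computable F -> computable G -> computable (fun v => F v + G v).
Proof.
move=> cF cG; apply: (@eq_computable
  (fun v => iteri (F v) (fun _ a => a.+1) (G v))) => [v|].
  by elim: (F v) => //= n ->; rewrite addSn.
by apply: computable_iteri => //; apply/computableS/computable_nth.
Qed.

Lemma computable_pred G : computable G -> computable (fun v => (G v).-1).
Proof.
move=> cG; apply: (@eq_computable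
  (fun v => iteri (G v) (fun i _ => i) 0)) => [v|]; first by case: (G v).
by apply: computable_iteri => //; [apply: computable_nth|apply: computable_cst].
Qed.

Lemma computableB F G :
  computable F -> computable G -> computable (fun v => F v - G v).
Proof.
move=> cF cG; apply: (@eq_computable
  (fun v => iteri (G v) (fun _ a => a.-1) (F v))) => [v|].
  by elim: (G v) => [|n /= ->]; rewrite ?subn0 ?subnS.
by apply: computable_iteri => //; apply/computable_pred/computable_nth.
Qed.

(** Skips the accumulator at entry 1, for loop bodies that depend only on the counter and the
    context. *)
Lemma computable_weaken F : computable (fun v => F (nth 0 v 0) (behead v)) ->
  computable (fun v => F (nth 0 v 0) (behead (behead v))).
Proof.
move=> cF; apply: (eq_computable _ (computable_cons 2 cF (computable_nth 0))) => v.
by rewrite /= -drop1 -drop1 drop_drop.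
Qed.

Lemma computable_sum F N :
  computable (fun v => F (nth 0 v 0) (behead v)) -> computable N ->
  computable (fun v => \sum_(i < N v) F i v).
Proof.
move=> cF cN; apply: (@eq_computable
  (fun v => iteri (N v) (fun i a => F i v + a) 0)) => [v|].
  elim: (N v) => [|n IHn]; first by rewrite big_ord0.
  by rewrite big_ord_recr /= -IHn addnC.
apply: computable_iteri => //; last exact: computable_cst.
apply: computableD; last exact: computable_nth.
exact: computable_weaken.
Qed.

Lemma computableM F G :
  computable F -> computable G -> computable (fun v => F v * G v).
Proof.
move=> cF cG; apply: (@eq_computable (fun v => \sum_(i < F v) G v)) => [v|].
  by rewrite sum_nat_const card_ord.
by apply: (@computable_sum (fun _ => G)) => //; apply: computable_behead.
Qed.

Lemma computableX F G :
  computable F -> computable G -> computable (fun v => F v ^ G v).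
Proof.
move=> cF cG; apply: (@eq_computable
  (fun v => iteri (G v) (fun _ a => F v * a) 1)) => [v|].
  by elim: (G v) => //= n ->; rewrite expnS.
apply: computable_iteri => //; last exact: computable_cst.
apply: computableM; last exact: computable_nth.
exact: computable_behead (computable_behead cF).
Qed.

Lemma computable_leq F G :
  computable F -> computable G -> computable (fun v => F v <= G v : nat).
Proof.
move=> cF cG; apply: (@eq_computable (fun v => 1 - (F v - G v))) => [v|].
  by rewrite /leq; case: (F v - G v) => // n; rewrite subSS sub0n.
by do 2?apply: computableB => //; apply: computable_cst.
Qed.

Lemma computable_and (P Q : seq nat -> bool) :
  computable P -> computable Q -> computable (fun v => P v && Q v : nat).
Proof.
move=> cP cQ; apply: (@eq_computable (fun v => P v * Q v)) => [v|].
  by rewrite mulnb.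
exact: computableM.
Qed.

Lemma computable_neg (P : seq nat -> bool) :
  computable P -> computable (fun v => ~~ P v : nat).
Proof.
move=> cP; apply: (@eq_computable (fun v => 1 - P v)) => [v|].
  by case: (P v).
by apply: computableB => //; apply: computable_cst.
Qed.

Lemma computable_or (P Q : seq nat -> bool) :
  computable P -> computable Q -> computable (fun v => P v || Q v : nat).
Proof.
move=> cP cQ; apply: (@eq_computable (fun v => ~~ (~~ P v && ~~ Q v))) => [v|].
  by rewrite negb_and !negbK.
by apply/computable_neg/computable_and; apply: computable_neg.
Qed.

Lemma computable_eq F G :
  computable F -> computable G -> computable (fun v => F v == G v : nat).
Proof.
move=> cF cG; apply: (@eq_computable (fun v => (F v <= G v) && (G v <= F v))).
  by move=> v; rewrite eqn_leq.
by apply: computable_and; apply: computable_leq.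
Qed.

Lemma computable_if (P : seq nat -> bool) F G :
  computable P -> computable F -> computable G ->
  computable (fun v => if P v then F v else G v).
Proof.
move=> cP cF cG; apply: (@eq_computable (fun v => P v * F v + ~~ P v * G v)).
  by move=> v; case: (P v); rewrite ?mul1n ?mul0n ?addn0.
by apply: computableD; apply: computableM => //; apply: computable_neg.
Qed.

Lemma computable_count (P : nat -> seq nat -> bool) N :
  computable (fun v => P (nth 0 v 0) (behead v)) -> computable N ->
  computable (fun v => count (P^~ v) (iota 0 (N v))).
Proof.
move=> cP cN; apply: (@eq_computable (fun v => \sum_(i < N v) P i v)) => [v|].
  rewrite -(big_mkord xpredT (fun i => P i v : nat)) /index_iota subn0.
  by rewrite -sum1_count [RHS]big_mkcond; apply: eq_bigr => i _; case: (P i v).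
exact: (@computable_sum (fun i v => P i v)).
Qed.

Lemma computable_all (P : nat -> seq nat -> bool) N :
  computable (fun v => P (nth 0 v 0) (behead v)) -> computable N ->
  computable (fun v => all (P^~ v) (iota 0 (N v))).
Proof.
move=> cP cN; apply: (@eq_computable
  (fun v => count (P^~ v) (iota 0 (N v)) == N v)) => [v|].
  by rewrite all_count size_iota.
by apply: computable_eq => //; apply: computable_count.
Qed.

Lemma computable_has (P : nat -> seq nat -> bool) N :
  computable (fun v => P (nth 0 v 0) (behead v)) -> computable N ->
  computable (fun v => has (P^~ v) (iota 0 (N v))).
Proof.
move=> cP cN; apply: (@eq_computable
  (fun v => 1 <= count (P^~ v) (iota 0 (N v)))) => [v|].
  by rewrite has_count.
by apply: computable_leq; [apply: computable_cst|apply: computable_count].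
Qed.

Lemma computable_mem (s : seq nat) F :
  computable F -> computable (fun v => F v \in s : nat).
Proof.
move=> cF; elim: s => [|x s IHs]; first exact: computable_cst.
apply: (@eq_computable (fun v => (F v == x) || (F v \in s))) => [v|].
  by rewrite inE.
by apply: computable_or => //; apply: computable_eq => //; apply: computable_cst.
Qed.

(** Unbounded search finds the only solution of a decidable relation. Decoding functions thus become
    computable through their graphs, with no bound on their values. *)
Lemma computable_unique (P : nat -> seq nat -> bool) G :
  computable (fun v => P (nth 0 v 0) (behead v)) ->
  (forall v, P (G v) v) -> (forall v n, P n v -> n = G v) -> computable G.
Proof.
move=> cP PG Guniq; apply: (computable_mu (computable_neg cP)) => /= [v|v n nG].
  by rewrite PG.
by case: (boolP (P n v)) => // /Guniq nE; rewrite nE ltnn in nG.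
Qed.

(** * Computable operations on codes of lists *)

Lemma code_cons h t : 2 ^ h * (t + t).+1 = CodeSeq.code (h :: CodeSeq.decode t).
Proof. by rewrite /= CodeSeq.decodeK addnn. Qed.

Ltac solve_computable := repeat first
  [ assumption
  | exact: computable_nth
  | exact: computable_cst
  | exact: computable_behead (computable_nth _)
  | exact: computable_behead (computable_behead (computable_nth _))
  | apply: computable_behead; assumption
  | apply: computable_behead (computable_behead _); assumption
  | apply: computable_and
  | apply: computable_or
  | apply: computable_neg
  | apply: computable_leq
  | apply: computable_eq
  | apply: computableS
  | apply: computableD
  | apply: computableM
  | apply: computableX ].

(** The graph is decidable: [c] and [t] are both 0, or [c] is [2 ^ h * (t + t).+1] for some [h],
    where [h < c] bounds the quantifier. *)
Lemma computable_decode_tail F : computable F ->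
  computable (fun v => CodeSeq.code (behead (CodeSeq.decode (F v)))).
Proof.
apply: (@computable_comp1 (fun c => CodeSeq.code (behead (CodeSeq.decode c)))).
pose P t v := let c := nth 0 v 0 in (c == 0) && (t == 0) ||
  has (fun h => 2 ^ h * (t + t).+1 == c) (iota 0 c).
apply: (@computable_unique P) => [|v|v t].
- apply: computable_or; first by solve_computable.
  pose Q h v := 2 ^ h * (nth 0 v 0 + nth 0 v 0).+1 == nth 0 (behead v) 0.
  by apply: (@computable_has Q); rewrite /Q; solve_computable.
- rewrite /P; move: (nth 0 v 0) => c.
  case E: (CodeSeq.decode c) => [|h s].
    by rewrite -(CodeSeq.decodeK c) E.
  have cE : c = CodeSeq.code (h :: s) by rewrite -E CodeSeq.decodeK.
  apply/orP; right; apply/hasP; exists h.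
    by have := CodeSeq.gtn_decode c; rewrite E mem_iota /= => /andP[].
  by rewrite code_cons CodeSeq.codeK -cE.
- rewrite /P; move: (nth 0 v 0) => c /orP[/andP[/eqP-> /eqP->]//|].
  by case/hasP => h _ /eqP <-; rewrite code_cons CodeSeq.codeK /= CodeSeq.decodeK.
Qed.

Lemma computable_drop F G : computable F -> computable G ->
  computable (fun v => CodeSeq.code (drop (G v) (CodeSeq.decode (F v)))).
Proof.
move=> cF cG; pose tl c := CodeSeq.code (behead (CodeSeq.decode c)).
apply: (@eq_computable (fun v => iteri (G v) (fun _ => tl) (F v))) => [v|].
  elim: (G v) => [|n /= ->]; first by rewrite drop0 CodeSeq.decodeK.
  by rewrite /tl CodeSeq.codeK -drop1 drop_drop.
by apply: computable_iteri => //; apply/computable_decode_tail/computable_nth.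
Qed.

(** The entry is the head of what remains after dropping; it is searched for, while the code of the
    tail is quantified boundedly. Code 0 means that the list is exhausted and yields the default
    0. *)
Lemma computable_decode_nth F G : computable F -> computable G ->
  computable (fun v => nth 0 (CodeSeq.decode (F v)) (G v)).
Proof.
apply: (@computable_app2 (fun c i => nth 0 (CodeSeq.decode c) i)).
pose d v := CodeSeq.code (drop (nth 0 v 1) (CodeSeq.decode (nth 0 v 0))).
have cd : computable d by apply: computable_drop; apply: computable_nth.
pose P h v := (d v == 0) && (h == 0) ||
  has (fun t => 2 ^ h * (t + t).+1 == d v) (iota 0 (d v)).
apply: (@computable_unique P) => [|v|v h].
- apply: computable_or; first by solve_computable.
  pose Q t v := 2 ^ (nth 0 v 0) * (t + t).+1 == d (behead v).
  by apply: (@computable_has Q); rewrite /Q; solve_computable.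
- rewrite /P /d; set s := CodeSeq.decode _.
  have [si|si] := leqP (size s) (nth 0 v 1).
    by rewrite drop_oversize // nth_default.
  rewrite (drop_nth 0) //; set h := nth _ _ _; set t := drop _ _.
  apply/orP; right; apply/hasP; exists (CodeSeq.code t).
    rewrite mem_iota /= add0n (leq_trans _ (leq_pmull _ (expn_gt0 2 h))) //.
    by rewrite ltnS -addnn leq_addr.
  by rewrite code_cons CodeSeq.codeK.
- rewrite /P /d; set s := CodeSeq.decode _.
  rewrite -[in nth _ _ (nth _ _ _)](addn0 (nth 0 v 1)) -nth_drop.
  move: (drop _ _) => u /orP[/andP[/eqP u0 /eqP->]|/hasP[t _ /eqP]].
    by rewrite -(CodeSeq.codeK u) u0.
  by rewrite code_cons => /(can_inj CodeSeq.codeK) <-.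
Qed.

(** The size is the least number of entries whose removal leaves the empty list, the only one with
    code 0. *)
Lemma computable_decode_size F : computable F ->
  computable (fun v => size (CodeSeq.decode (F v))).
Proof.
apply: (@computable_comp1 (fun c => size (CodeSeq.decode c))).
pose d i c := CodeSeq.code (drop i (CodeSeq.decode c)).
have d0 i c : (d i c == 0) = (size (CodeSeq.decode c) <= i).
  rewrite /d -subn_eq0 -size_drop; case: (drop _ _) => //= x s.
  by rewrite muln_eq0 expn_eq0.
pose P n v := (d n (nth 0 v 0) == 0) &&
  all (fun i => d i (nth 0 v 0) != 0) (iota 0 n).
apply: (@computable_unique P) => [|v|v n].
- apply: computable_and.
    by apply: computable_eq (computable_drop _ _) _; solve_computable.
  pose Q i v := d i (nth 0 (behead v) 0) != 0.
  apply: (@computable_all Q); last by solve_computable.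
  apply/computable_neg/(computable_eq (computable_drop _ _) _); solve_computable.
- rewrite /P d0 leqnn; apply/allP => i; rewrite mem_iota => /andP[_ ?].
  by rewrite d0 -ltnNge.
- rewrite /P d0 => /andP[ge_n /allP lt_n]; apply/eqP; rewrite eqn_leq ge_n andbT.
  case: n ge_n lt_n => // n _ /(_ n); rewrite d0 -ltnNge; apply.
  by rewrite mem_iota /=.
Qed.

(** Every number codes exactly one list, so the code sought is pinned down by the size and the
    entries. *)
Lemma computable_mkseq (f : nat -> seq nat -> nat) N :
  computable (fun v => f (nth 0 v 0) (behead v)) -> computable N ->
  computable (fun v => CodeSeq.code (mkseq (f^~ v) (N v))).
Proof.
move=> cf cN.
pose P t v := (size (CodeSeq.decode t) == N v) &&
  all (fun i => nth 0 (CodeSeq.decode t) i == f i v) (iota 0 (N v)).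
apply: (@computable_unique P) => [|v|v t].
- apply: computable_and.
    by apply: computable_eq (computable_decode_size _) _; solve_computable.
  pose Q i v := nth 0 (CodeSeq.decode (nth 0 v 0)) i == f i (behead v).
  apply: (@computable_all Q); last by solve_computable.
  apply: computable_eq (computable_decode_nth _ _) _; solve_computable.
  exact: computable_weaken.
- rewrite /P CodeSeq.codeK size_mkseq eqxx; apply/allP => i.
  by rewrite mem_iota => /andP[_ ?]; rewrite nth_mkseq.
- case/andP => /eqP szt /allP tE; rewrite -[LHS]CodeSeq.decodeK; congr CodeSeq.code.
  apply: (@eq_from_nth _ 0) => [|i]; rewrite ?size_mkseq // szt => iN.
  by rewrite nth_mkseq //; apply/eqP/tE; rewrite mem_iota.
Qed.

(** * The system attached to a conformity measure *)

(** An integer is pickled as a pair of optional naturals, one of them absent (code 0), with [Negz n]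
    standing for [-(n+1)]. [code_pos] and [code_neg] read off the positive and negative parts. *)
Definition code_pos z := nth 0 (CodeSeq.decode (nth 0 (CodeSeq.decode z) 0)) 0.

Definition code_neg z := let b := nth 0 (CodeSeq.decode z) 1 in
  if b == 0 then 0 else (nth 0 (CodeSeq.decode b) 0).+1.

Lemma code_intE (z : int) :
  z = ((code_pos (pickle z))%:Z - (code_neg (pickle z))%:Z)%R.
Proof.
case: z => n; rewrite /code_pos /code_neg.
  rewrite (_ : pickle (Posz n) = CodeSeq.code [:: CodeSeq.code [:: n]; 0]) //.
  by rewrite !CodeSeq.codeK /= subr0.
rewrite (_ : pickle (Negz n) = CodeSeq.code [:: 0; CodeSeq.code [:: n]]) //.
have n0 : (CodeSeq.code [:: n] == 0) = false by rewrite muln_eq0 expn_eq0.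
move: (CodeSeq.code [:: n]) n0 (CodeSeq.codeK [:: n]) => d d0 dK.
by rewrite CodeSeq.codeK /= d0 dK sub0r NegzE.
Qed.

(** Cross-multiplication, with negative parts moved across so that only natural numbers occur. *)
Definition code_rat_le a b :=
  let na := nth 0 (CodeSeq.decode a) 0 in
  let da := code_pos (nth 0 (CodeSeq.decode a) 1) in
  let nb := nth 0 (CodeSeq.decode b) 0 in
  let db := code_pos (nth 0 (CodeSeq.decode b) 1) in
  code_pos na * db + code_neg nb * da <= code_pos nb * da + code_neg na * db.

Lemma code_rat_leE (x y : rat) : code_rat_le (pickle x) (pickle y) = (x <= y)%R.
Proof.
have pickleE (q : rat) :
  pickle q = CodeSeq.code [:: pickle (numq q); pickle (denq q)] by [].
have denE (q : rat) : ((code_pos (pickle (denq q)))%:Z = denq q)%R.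
  case: (denq q) (denq_gt0 q) => // n _; rewrite /code_pos.
  rewrite (_ : pickle (Posz n) = CodeSeq.code [:: CodeSeq.code [:: n]; 0]) //.
  by rewrite !CodeSeq.codeK.
rewrite /code_rat_le !pickleE !CodeSeq.codeK [RHS](_ : _ = le_rat x y) // le_ratE.
rewrite [in RHS](code_intE (numq x)) [in RHS](code_intE (numq y)) /=.
move: (code_pos (pickle (denq x))) (denE x) => dx <-.
move: (code_pos (pickle (denq y))) (denE y) => dy <-.
by rewrite !mulrBl lerBlDr addrAC lerBrDr -!PoszM -!PoszD.
Qed.

Lemma computable_code_pos F : computable F -> computable (fun v => code_pos (F v)).
Proof.
move=> cF; rewrite /code_pos.
by do 2 (apply: computable_decode_nth; last exact: computable_cst).
Qed.

Lemma computable_code_neg F : computable F -> computable (fun v => code_neg (F v)).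
Proof.
move=> cF; have cb : computable (fun v => nth 0 (CodeSeq.decode (F v)) 1).
  by apply: computable_decode_nth => //; apply: computable_cst.
apply: (@computable_if (fun v => nth 0 (CodeSeq.decode (F v)) 1 == 0)).
- by solve_computable.
- by solve_computable.
- by apply/computableS/computable_decode_nth => //; solve_computable.
Qed.

Lemma computable_code_rat_le F G : computable F -> computable G ->
  computable (fun v => code_rat_le (F v) (G v)).
Proof.
move=> cF cG; have cn i H : computable H ->
    computable (fun v => nth 0 (CodeSeq.decode (H v)) i).
  by move=> cH; apply: computable_decode_nth => //; apply: computable_cst.
by apply: computable_leq; apply: computableD; apply: computableM;
  do ?[apply: computable_code_pos|apply: computable_code_neg]; apply: cn.
Qed.

(** A nonempty decidable set is enumerated by sending members to themselves and all other numbers to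
    a fixed member. *)
Lemma recursively_enumerable_computable (T : countType) (B : set T)
    (chi : nat -> bool) :
  computable (fun v => chi (nth 0 v 0)) ->
  (forall n, chi n <-> (pickle @` B) n) -> recursively_enumerable B.
Proof.
move=> cchi chiE; have [->|/set0P[b Bb]] := eqVneq B set0; first by left.
right; exists (fun v => if chi (nth 0 (tval v) 0) then nth 0 (tval v) 0
                        else pickle b).
  exact: (computable_if cchi (computable_nth 0) (computable_cst _)).
apply/seteqP; split => n /=.
  by move=> /chiE chin; exists n => //=; rewrite chin.
by case=> j _ <-; case: ifPn => [/chiE//|_]; exists b.
Qed.


Lemma sub_in_count (T : eqType) (a b : pred T) (s : seq T) :
  {in s, subpred a b} -> count a s <= count b s.
Proof.
move=> ab; rewrite (@eq_in_count _ a (predI a b)) => [|x xs /=].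
  by apply: sub_count => x /andP[].
by case: (boolP (a x)) => // /(ab x xs) ->.
Qed.

Section ConformalSystem.
Variables (Z : finType) (A : forall n, n.-tuple Z -> n.-tuple rat).

Definition scores (s : seq Z) : seq rat := A (in_tuple s).

Definition last_rank (s : seq Z) : nat :=
  count (fun a => a <= last 0 (scores s))%R (scores s).

(** For nonempty [s]: the last p-value is at most [2^-(k+1)], written without division. *)
Definition hit (k : nat) (s : seq Z) : bool := last_rank s * 2 ^ k.+1 <= size s.

Definition hits (k : nat) (s : seq Z) : nat :=
  count (fun i => hit k (take i.+1 s)) (iota 0 (size s)).

(* The p-value threshold is half of the frequency allowed to the m-th set, so
   that the second condition eventually holds almost surely. *)
Definition conformal_system (m : nat) : set (seq Z) :=
  [set s | hit m s && all (fun k => hits k s * 2 ^ k <= size s) (iota 0 m.+1)].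

Lemma size_scores s : size (scores s) = size s.
Proof. by rewrite size_tuple. Qed.

Hypothesis cA : computable_measure A.

(** The realizer of [A] maps the code of [s] to the code of its scores, which [code_rat_le]
    compares. Only the values of [r] at codes of sequences are specified. *)
Lemma computable_last_rank : exists2 r : nat -> nat,
  computable (fun v => r (nth 0 v 0)) & forall s, r (pickle s) = last_rank s.
Proof.
have [f rf fE] := cA.
pose sc c i := nth 0 (CodeSeq.decode (f [tuple c])) i.
pose sz c := size (CodeSeq.decode (f [tuple c])).
exists (fun c =>
  count (fun i => code_rat_le (sc c i) (sc c (sz c).-1)) (iota 0 (sz c))).
  have csc G H : computable G -> computable H ->
      computable (fun v => sc (G v) (H v)).
    by move=> cG cH; apply: computable_decode_nth; first exact: computable_app1.
  have csz G : computable G -> computable (fun v => sz (G v)).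
    by move=> cG; apply: computable_decode_size; apply: computable_app1.
  pose P i v := code_rat_le (sc (nth 0 v 0) i) (sc (nth 0 v 0) (sz (nth 0 v 0)).-1).
  apply: (@computable_count P (fun v => sz (nth 0 v 0)));
    last exact/csz/computable_nth.
  have c0 := computable_behead (computable_nth 0).
  apply: computable_code_rat_le; apply: csc => //; first exact: computable_nth.
  exact/computable_pred/csz.
move=> s; have decE : CodeSeq.decode (f [tuple pickle s]) = map pickle (scores s).
  by rewrite (fE _ (in_tuple s)) CodeSeq.codeK.
have szE : sz (pickle s) = size (scores s) by rewrite /sz decE size_map.
have scE i : i < size s -> sc (pickle s) i = pickle (nth 0%R (scores s) i).
  by move=> i_s; rewrite /sc decE (nth_map 0%R) ?size_scores.
rewrite szE /last_rank -nth_last; set le_last := fun a => _.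
rewrite -[X in _ = count _ X](mkseq_nth 0%R) count_map.
apply: eq_in_count => i; rewrite mem_iota size_scores /= add0n => i_s.
rewrite /le_last !scE ?code_rat_leE ?size_scores //.
by case: (size s) i_s.
Qed.

(** Membership is even decidable: each ingredient of the definition is mirrored by a computable
    function on codes. *)
Lemma conformal_system_re :
  recursively_enumerable [set p : seq Z * nat | conformal_system p.2 p.1].
Proof.
have [r cr rE] := computable_last_rank.
pose pre i c := CodeSeq.code (mkseq (nth 0 (CodeSeq.decode c)) i).
pose sz c := size (CodeSeq.decode c).
pose hitc k c := r c * 2 ^ k.+1 <= sz c.
pose hitsc k c := count (fun i => hitc k (pre i.+1 c)) (iota 0 (sz c)).
pose sysc m c := hitc m c && all (fun k => hitsc k c * 2 ^ k <= sz c) (iota 0 m.+1).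
have szE (s : seq Z) : sz (pickle s) = size s by rewrite /sz CodeSeq.codeK size_map.
have hitE k s : hitc k (pickle s) = hit k s by rewrite /hitc rE szE.
have preE i (s : seq Z) : i <= size s -> pre i (pickle s) = pickle (take i s).
  move=> i_s; rewrite /pre CodeSeq.codeK; congr CodeSeq.code.
  apply: (@eq_from_nth _ 0) => [|j]; rewrite ?size_mkseq ?size_map ?size_takel //.
  by move=> ji; rewrite nth_mkseq // map_take nth_take.
have hitsE k s : hitsc k (pickle s) = hits k s.
  rewrite /hitsc szE; apply: eq_in_count => i; rewrite mem_iota => /andP[_ i_s].
  by rewrite preE // hitE.
have syscE m s : sysc m (pickle s) = (s \in conformal_system m).
  rewrite /sysc szE hitE.
  rewrite (@eq_all _ _ (fun k => hits k s * 2 ^ k <= size s)) => [|k].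
    by apply/idP/idP; rewrite inE.
  by rewrite hitsE.
(* Numbers that do not code a pair with a sequence over [Z] must be rejected; as [Z] is finite, a
   finite list of codes decides this. *)
pose zs := [seq pickle z | z <- enum Z].
pose chi n := let c := nth 0 (CodeSeq.decode n) 0 in
  [&& sz n == 2, all (fun j => nth 0 (CodeSeq.decode c) j \in zs) (iota 0 (sz c))
    & sysc (nth 0 (CodeSeq.decode n) 1) c].
apply: (@recursively_enumerable_computable _ _ chi).
  have csz F : computable F -> computable (fun v => sz (F v)).
    exact: computable_decode_size.
  have chit K F : computable K -> computable F ->
      computable (fun v => hitc (K v) (F v)).
    move=> cK cF; have crF := computable_comp1 cr cF; have cszF := csz _ cF.
    by rewrite /hitc; solve_computable.
  have chits K F : computable K -> computable F ->
      computable (fun v => hitsc (K v) (F v)).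
    move=> cK cF.
    apply: (@computable_count (fun i v => hitc (K v) (pre i.+1 (F v))));
      last exact: csz.
    apply: (@chit (fun v => K (behead v))); first exact: computable_behead.
    apply: (@computable_mkseq (fun i v => nth 0 (CodeSeq.decode (F (behead v))) i)
      (fun v => (nth 0 v 0).+1)); last by solve_computable.
    apply: computable_decode_nth; last exact: computable_nth.
    exact: computable_behead (computable_behead cF).
  pose c v := nth 0 (CodeSeq.decode (nth 0 v 0)) 0.
  pose m v := nth 0 (CodeSeq.decode (nth 0 v 0)) 1.
  have cc : computable c by apply: computable_decode_nth; solve_computable.
  have cm : computable m by apply: computable_decode_nth; solve_computable.
  apply: computable_and.
    by apply: computable_eq; [apply: csz|]; solve_computable.
  apply: computable_and.
    apply: (@computable_all (fun j v => nth 0 (CodeSeq.decode (c v)) j \in zs));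
      last exact: csz.
    by apply/computable_mem/computable_decode_nth; solve_computable.
  apply: computable_and; first exact: chit.
  apply: (@computable_all (fun k v => hitsc k (c v) * 2 ^ k <= sz (c v)));
    last by solve_computable.
  have cc1 := computable_behead cc; have csz1 := csz _ cc1.
  by have chits1 := chits _ _ (computable_nth 0) cc1; solve_computable.
have pickleE (p : seq Z * nat) : pickle p = CodeSeq.code [:: pickle p.1; p.2] by [].
move=> n; split.
  case/and3P => szn /allP cZ sysn.
  (* Every number codes a list of numbers, so it suffices that all entries code elements of [Z]. *)
  have [s sE] : exists s : seq Z, pickle s = nth 0 (CodeSeq.decode n) 0.
    have {cZ} : {subset CodeSeq.decode (nth 0 (CodeSeq.decode n) 0) <= zs}.
      by move=> x /(nthP 0)[j jlt <-]; apply: cZ; rewrite mem_iota.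
    rewrite -[X in exists _, _ = X]CodeSeq.decodeK.
    elim: (CodeSeq.decode _) => [|x t IHt] subt; first by exists [::].
    have [|s sE] := IHt; first by move=> y yt; apply: subt; rewrite inE yt orbT.
    have /mapP[z _ xE] := subt x (mem_head _ _).
    by exists (z :: s); rewrite xE /= -sE.
  exists (s, nth 0 (CodeSeq.decode n) 1).
    by move: sysn; rewrite -sE syscE inE.
  rewrite pickleE [(_, _).1]/= [(_, _).2]/= sE -[RHS]CodeSeq.decodeK.
  by move: szn; rewrite /sz; case: (CodeSeq.decode n) => [|x [|y []]].
case=> -[s m] sys <-; rewrite /chi {1}/sz pickleE CodeSeq.codeK.
rewrite -[nth _ _ 0]/(pickle s) -[nth _ _ 1]/m syscE andTb.
apply/andP; split; last by rewrite inE.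
apply/allP => j; rewrite mem_iota szE add0n => /andP[_ js].
have z0 : Z by case: s js {sys}.
by rewrite CodeSeq.codeK (nth_map z0) // map_f ?mem_enum.
Qed.

(** The frequency bound goes by induction on [l]. If the prefix of length [l + 1] is outside the
    set, the count is unchanged; otherwise its own condition at [k = m] bounds its hits, and these
    include all members so far. *)
Lemma conformal_system_spec : randomness_prediction_system conformal_system.
Proof.
split; first exact: conformal_system_re.
(* Testing the frequencies for all [k <= m], not just for [m], makes the sets decrease. *)
- move=> m s /andP[hs /allP alls]; apply/andP; split.
    by rewrite /hit (leq_trans _ hs) // leq_mul2l leq_exp2l // leqnSn orbT.
  apply/allP => k; rewrite mem_iota => /andP[_ km]; apply: alls.
  by rewrite mem_iota (leq_trans km).
move=> m l w l0.
suff main : count (fun i => mkseq w i.+1 \in conformal_system m) (iota 0 l) * 2 ^ m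
    <= l.
  rewrite mulrC ler_pdivlMr ?exprn_gt0 // -natrX -natrM ler_nat.
  apply: leq_trans main; rewrite leq_mul2r; apply/orP; right.
  rewrite -sum1_card -sum1_count [leqRHS]big_mkcond [leqLHS]big_mkcond /=.
  rewrite -[l in iota 0 l]subn0 -/(index_iota 0 l).
  by rewrite (big_mkord xpredT (fun i =>
    if mkseq w i.+1 \in conformal_system m then 1 else 0)).
elim: l {l0} => // l IHl.
have [|nsys] := boolP (mkseq w l.+1 \in conformal_system m); last first.
  rewrite -[in iota 0 _]addn1 iotaD count_cat [count _ (iota _ 1)]/= add0n.
  by rewrite (negbTE nsys) !addn0 leqW.
rewrite inE => /andP[_ /allP/(_ m)].
rewrite mem_iota ltnS leqnn size_mkseq => /(_ isT); apply: leq_trans.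
rewrite leq_mul2r; apply/orP; right; rewrite /hits size_mkseq.
apply: sub_in_count => i; rewrite mem_iota add0n => /andP[_ il].
by rewrite inE -map_take take_iota (minn_idPl _) // => /andP[].
Qed.

End ConformalSystem.

(** * Frequency of small p-values *)

Section ConformityScores.
Variables (Z : finType) (A : forall n, n.-tuple Z -> n.-tuple rat).
Hypothesis cfA : conformity_measure A.
Local Notation scores := (scores A).

(* By equivariance the scores depend only on the multiset of data and on the
   datum scored. *)
Definition score (s : seq Z) (z : Z) : rat := nth 0%R (scores s) (index z s).

Definition rank (s : seq Z) (z : Z) : nat :=
  count (fun z' => score s z' <= score s z)%R s.

Lemma scores_tuple n (t : n.-tuple Z) : scores t = A t.
Proof.
case: t => t szt; have szE := eqP szt; rewrite /scores /=; subst n.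
by congr (tval (A _)); apply: val_inj.
Qed.

(** Transposing two equal data leaves the tuple fixed, so equivariance equates their scores. *)
Lemma nth_scores_eq s z0 i j : i < size s -> j < size s ->
  nth z0 s i = nth z0 s j -> nth 0%R (scores s) i = nth 0%R (scores s) j.
Proof.
move=> i_s j_s sij; pose t := in_tuple s.
have szA : size s = size (scores s) by rewrite size_scores.
have := cfA (tperm (Ordinal i_s) (Ordinal j_s)) t.
rewrite (_ : [tuple _ | _ < _] = t); last first.
  apply: eq_from_tnth => l; rewrite tnth_mktuple.
  by case: tpermP => // ->; rewrite !(tnth_nth z0).
move/(congr1 (fun u => tnth u (Ordinal i_s))).
by rewrite tnth_mktuple tpermL !(tnth_nth 0%R).
Qed.

Lemma scoresE s : scores s = [seq score s z | z <- s].
Proof.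
case: s => [|z0 s']; first by apply: size0nil; rewrite size_scores.
move: (z0 :: s') => s; apply: (@eq_from_nth _ 0%R) => [|i].
  by rewrite size_map size_scores.
rewrite size_scores => i_s; rewrite (nth_map z0) // /score.
have z_s : nth z0 s i \in s by apply: mem_nth.
by apply: (@nth_scores_eq s z0); rewrite ?index_mem ?nth_index.
Qed.

Lemma score_perm s t z : perm_eq s t -> z \in s -> score s z = score t z.
Proof.
move=> /[dup] pst /(@tuple_permP _ _ _ (in_tuple t))[p sE] zs.
have zt : z \in t by rewrite -(perm_mem pst).
have sz := perm_size pst.
have scE : scores s = [tuple tnth (A (in_tuple t)) (p i) | i < size t].
  by rewrite sE scores_tuple cfA.
have i_t : index z s < size t by rewrite -sz index_mem.
rewrite {1}/score scE -[index z s]/(val (Ordinal i_t)) -tnth_nth tnth_mktuple.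
(* The permutation may lead to an occurrence of [z] in [t] other than the first; equal data have
   equal scores. *)
rewrite (tnth_nth 0%R) /score; apply: (@nth_scores_eq _ z); rewrite ?index_mem //.
rewrite nth_index //; have := nth_index z zs; rewrite {1}sE.
by rewrite -[index z s]/(val (Ordinal i_t)) -tnth_nth tnth_mktuple (tnth_nth z).
Qed.

Lemma rank_perm s t z : perm_eq s t -> z \in s -> rank s z = rank t z.
Proof.
move=> pst zs; rewrite /rank -(seq.permP pst); apply: eq_in_count => z' z's.
by rewrite !(score_perm pst).
Qed.

Lemma last_rank_rcons s z : last_rank A (rcons s z) = rank (rcons s z) z.
Proof.
by rewrite /last_rank scoresE map_rcons last_rcons -map_rcons count_map.
Qed.

Lemma hit_rcons k s z :
  hit A k (rcons s z) = (rank (rcons s z) z * 2 ^ k.+1 <= size (rcons s z)).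
Proof. by rewrite /hit last_rank_rcons. Qed.

Lemma hit_perm k s t z :
  perm_eq s t -> hit A k (rcons s z) = hit A k (rcons t z).
Proof.
move=> pst; have prst : perm_eq (rcons s z) (rcons t z).
  by rewrite -!cats1 perm_cat2r.
by rewrite !hit_rcons (perm_size prst) (rank_perm prst) ?mem_rcons ?mem_head.
Qed.

(* The largest datum of small rank already dominates all the others. *)
Lemma count_small_rank s N M :
  count (fun z => rank s z * M <= N) s * M <= N.
Proof.
pose P z := rank s z * M <= N.
have [/hasP[z zs Pz]|/hasPn nP] := boolP (has P s); last first.
  by rewrite (@eq_in_count _ P pred0) ?count_pred0 // => z /nP /negbTE.
have [z' + r_le] : exists2 z', z' \in [seq z <- s | P z] &
    forall y, y \in [seq z <- s | P z] -> (score s y <= score s z')%R.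
  have : z \in [seq z <- s | P z] by rewrite mem_filter Pz.
  elim: [seq _ <- _ | _] z {zs Pz} => // x [|y t] IHt z _.
    by exists x => [|y]; rewrite ?mem_head // inE => /eqP->.
  have [z' z't z'_le] := IHt y (mem_head _ _).
  have [xz'|/ltW z'x] := leP (score s x) (score s z').
    exists z' => [|w]; first by rewrite inE z't orbT.
    by rewrite inE => /predU1P[->|/z'_le].
  exists x => [|w]; first by rewrite mem_head.
  by rewrite inE => /predU1P[->//|/z'_le/le_trans]; apply.
rewrite mem_filter => /andP[Pz' _]; apply: leq_trans Pz'.
rewrite leq_mul2r; apply/orP; right; apply: sub_in_count => y ys Py.
by apply: r_le; rewrite mem_filter ys andbT.
Qed.

Lemma hits_rcons k s z :
  hits A k (rcons s z) = hits A k s + hit A k (rcons s z).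
Proof.
rewrite /hits size_rcons -addn1 iotaD count_cat add0n /= addn0.
rewrite take_oversize ?size_rcons //; congr (_ + _).
apply: eq_in_count => i; rewrite mem_iota add0n => /andP[_ i_s].
by rewrite -cats1 takel_cat.
Qed.

End ConformityScores.

Section ErrorFrequency.
Local Open Scope ring_scope.
Variables (R : realType) (Z : finType) (A : forall n, n.-tuple Z -> n.-tuple rat).
Hypothesis cfA : conformity_measure A.

Lemma sum_tuple_rcons n (F : seq Z -> R) :
  \sum_(t : n.+1.-tuple Z) F t = \sum_(z : Z) \sum_(t : n.-tuple Z) F (rcons t z).
Proof.
rewrite pair_big /=; pose h (p : Z * n.-tuple Z) := [tuple of rcons p.2 p.1].
rewrite (reindex h) //; apply/onW_bij/inj_card_bij => [[z t] [z' t']|].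
  by move=> /(congr1 val)/rcons_inj[/val_inj-> ->].
by rewrite card_prod !card_tuple expnS.
Qed.

Section Exchangeable.
Variable (W : seq Z -> R).
Hypotheses (W_ge0 : forall s, 0 <= W s)
  (W_perm : forall s t, perm_eq s t -> W s = W t).

(** Under an exchangeable weight each position is as likely as the last one to have small rank.
    Summing over the [n + 1] positions reduces the claim to [count_small_rank] for each tuple. *)
Lemma sum_hit k n :
  (\sum_(t : n.+1.-tuple Z) W t * (hit A k t)%:R) * 2 ^+ k.+1 <=
  \sum_(t : n.+1.-tuple Z) W t.
Proof.
pose S i := \sum_(t : n.+1.-tuple Z)
  W t * (rank A t (tnth t i) * 2 ^ k.+1 <= n.+1)%N%:R.
have SE i : S i = \sum_(t : n.+1.-tuple Z) W t * (hit A k t)%:R.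
  (* Exchanging position [i] with the last one preserves weights and ranks. *)
  pose h (t : n.+1.-tuple Z) := [tuple tnth t (tperm i ord_max j) | j < n.+1].
  have hK : involutive h.
    by move=> t; apply: eq_from_tnth => j; rewrite !tnth_mktuple tpermK.
  rewrite /S (reindex h); last by exists h => t _; apply: hK.
  apply: eq_bigr => t _.
  have pt : perm_eq (h t) t by apply/tuple_permP; exists (tperm i ord_max).
  rewrite (W_perm pt) tnth_mktuple tpermL (rank_perm cfA pt); last first.
    by rewrite (perm_mem pt) mem_tnth.
  congr (_ * (nat_of_bool _)%:R); rewrite (tnth_nth (thead t)) /=.
  move: (thead t) (tval t) (size_tuple t) => z0 s.
  case/lastP: s => // s z; rewrite size_rcons => -[szs].
  by rewrite hit_rcons // nth_rcons -szs ltnn eqxx size_rcons.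
rewrite -(ler_pM2l (ltr0Sn R n)) mulrA.
rewrite (_ : n.+1%:R * _ = \sum_i S i); last first.
  by rewrite (eq_bigr _ (fun i _ => SE i)) sumr_const card_ord mulr_natl.
rewrite exchange_big /= mulr_suml mulr_sumr; apply: ler_sum => t _.
rewrite -mulr_sumr -mulrA [leRHS]mulrC ler_wpM2l // -natr_sum -natrX -natrM ler_nat.
rewrite (_ : \sum_i _ = count (fun z => rank A t z * 2 ^ k.+1 <= n.+1)%N t).
  exact: count_small_rank.
by rewrite -sum1_count big_tuple [RHS]big_mkcond; apply: eq_bigr => i _; case: ifP.
Qed.

End Exchangeable.

(* The factor coming from the last datum is symmetric in the earlier data, so it
   can be absorbed into the weight before applying the induction hypothesis. *)
Lemma exp_moment (a : R) k n (W : seq Z -> R) : 1 <= a ->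
  (forall s, 0 <= W s) -> (forall s t, perm_eq s t -> W s = W t) ->
  \sum_(t : n.-tuple Z) W t * a ^+ hits A k t <=
  (1 + (a - 1) / 2 ^+ k.+1) ^+ n * \sum_(t : n.-tuple Z) W t.
Proof.
move=> a1; set C := 1 + _; elim: n W => [|n IHn] W W0 Wperm.
  rewrite expr0 mul1r; apply: ler_sum => t _.
  by rewrite tuple0 /= /hits /= expr0 mulr1.
have C0 : 0 <= C by rewrite addr_ge0 // divr_ge0 ?exprn_ge0 // subr_ge0.
have W'0 s z : 0 <= W (rcons s z) * a ^+ hit A k (rcons s z).
  by rewrite mulr_ge0 // exprn_ge0 // (le_trans ler01).
rewrite (sum_tuple_rcons n (fun t => W t * a ^+ hits A k t)).
apply: (@le_trans _ _ (C ^+ n *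
    \sum_(t : n.+1.-tuple Z) W t * a ^+ hit A k t)).
  rewrite (sum_tuple_rcons n (fun t => W t * a ^+ hit A k t)) mulr_sumr.
  apply: ler_sum => z _.
  under eq_bigr do rewrite hits_rcons exprD mulrCA mulrC.
  apply: (IHn (fun s => W (rcons s z) * a ^+ hit A k (rcons s z))) => // s t pst.
  by rewrite (hit_perm cfA k z pst) (Wperm _ (rcons t z)) // -!cats1 perm_cat2r.
rewrite exprSr -mulrA ler_wpM2l ?exprn_ge0 //.
(* A hit is 0 or 1, so [a ^+ hit] is [1 + (a - 1) * hit], and [sum_hit] then yields the factor
   [C]. *)
have -> : \sum_(t : n.+1.-tuple Z) W t * a ^+ hit A k t =
    \sum_(t : n.+1.-tuple Z) W t +
    (a - 1) * \sum_(t : n.+1.-tuple Z) W t * (hit A k t)%:R.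
  rewrite mulr_sumr -big_split /=; apply: eq_bigr => t _.
  by case: hit => /=; rewrite ?expr1 ?expr0; ring.
rewrite /C [leRHS]mulrDl mul1r lerD2l -mulrA ler_wpM2l ?subr_ge0 //.
by rewrite mulrC ler_pdivlMr ?exprn_gt0 // sum_hit.
Qed.

(** A Chernoff bound: Markov's inequality for the moment in [exp_moment]. The successors in the
    event leave room for one further datum, possibly a hit, because the bound is applied to the data
    preceding the predicted label. *)
Lemma excess_hits k : exists a rho : R, [/\ 0 <= a, 0 <= rho, rho < 1 &
  forall n (W : seq Z -> R),
    (forall s, 0 <= W s) -> (forall s t, perm_eq s t -> W s = W t) ->
    \sum_(t : n.-tuple Z | (n.+1 < (hits A k t).+1 * 2 ^ k)%N) W t <=
    a * rho ^+ n * \sum_(t : n.-tuple Z) W t].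
Proof.
pose M : R := 2 ^+ k; have M0 : 0 < M by rewrite exprn_gt0.
pose b : R := expR (4^-1 / M); pose a : R := expR 4^-1.
have b0 : 0 < b by apply: expR_gt0.
have bM : b ^+ (2 ^ k) = a.
  by rewrite -expRM_natl natrX -/M mulrC divfK // gt_eqF.
have a1 : 1 <= a by rewrite -expR0 ler_expR.
(* Equivalent to [exp(-1/4) >= 3/4], an instance of [exp x >= 1 + x]. *)
have a43 : a <= 4 / 3.
  rewrite /a -[4^-1]opprK expRN -[leRHS]invrK lef_pV2 ?posrE ?expR_gt0 //.
  by apply: le_trans (expR_ge1Dx _); lra.
pose C : R := 1 + (a - 1) / 2 ^+ k.+1.
have C0 : 0 <= C by rewrite addr_ge0 // divr_ge0 ?exprn_ge0 // subr_ge0.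
(* a <= 4/3 makes C smaller than 1 + 1/(4M) <= b. *)
exists a, (C / b); split.
- by rewrite (le_trans ler01).
- by rewrite divr_ge0 // ltW.
- rewrite ltr_pdivrMr // mul1r; apply: lt_le_trans (expR_ge1Dx _).
  rewrite ltrD2l exprS -/M invfM mulrA ltr_pM2r ?invr_gt0 //; lra.
move=> n W W0 Wperm; have b1 : 1 <= b.
  by rewrite (le_trans _ (expR_ge1Dx _)) // lerDl divr_ge0 // ltW.
apply: (@le_trans _ _ (\sum_(t : n.-tuple Z) W t * a ^+ hits A k t * (a / b ^+ n))).
  rewrite big_mkcond; apply: ler_sum => t _; case: ifP => [bad|_]; last first.
    by rewrite !mulr_ge0 ?invr_ge0 ?exprn_ge0 // ltW // (lt_le_trans _ a1).
  rewrite -mulrA ler_peMr // mulrA ler_pdivlMr ?exprn_gt0 // mul1r -exprSr -bM.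
  by rewrite -exprM ler_weXn2l // mulnC ltnW // ltnW.
rewrite -mulr_suml expr_div_n (_ : a * _ * _ =
  C ^+ n * (\sum_(t : n.-tuple Z) W t) * (a / b ^+ n)); last by ring.
apply: ler_wpM2r; last exact: exp_moment.
by rewrite divr_ge0 ?exprn_ge0 // ltW // (lt_le_trans _ a1).
Qed.

End ErrorFrequency.

(** * Borel-Cantelli for the infinite product measure *)

Section AlmostSure.
Local Open Scope ring_scope.

Lemma measure_bigsetU_le d (T : measurableType d) (R : realType)
    (mu : {measure set T -> \bar R}) (I : Type) (r : seq I) (p : pred I)
    (F : I -> set T) : (forall i, measurable (F i)) ->
  (mu (\big[setU/set0]_(i <- r | p i) F i) <= \sum_(i <- r | p i) mu (F i))%E.
Proof.
move=> mF; elim: r => [|i r IHr]; first by rewrite !big_nil measure0.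
rewrite !big_cons; case: (p i) => //.
apply: (le_trans (measureU2 _ _ _)) => //; last exact: leeD2l.
by apply: bigsetU_measurable.
Qed.

Lemma sum_outcome (R : realType) (Z : finType) (z0 : Z)
    (Q : probability (outcome z0) R) :
  \sum_(z : Z) fine (Q [set z]) = 1.
Proof.
suff: forall r : seq Z, uniq r ->
    (\sum_(z <- r) fine (Q [set z]))%:E = Q [set` r].
  move=> /(_ (index_enum Z) (index_enum_uniq Z)) QE.
  apply: EFin_inj; rewrite QE -(@probability_setT _ _ _ Q); congr (Q _).
  by apply/seteqP; split => z //= _; rewrite mem_index_enum.
elim=> [_|z r IHr /andP[zr ur]].
  by rewrite big_nil set_nil measure0.
rewrite big_cons EFinD IHr //.
have -> : [set` z :: r] = [set z] `|` [set` r].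
  apply/seteqP; split=> y /=; rewrite inE; first by case/predU1P; [left|right].
  by case=> [->|->]; rewrite ?eqxx ?orbT.
rewrite measureU //.
- by rewrite fineK // fin_num_measure.
- by rewrite -subset0 => y [/= ->]; rewrite (negbTE zr).
Qed.

Section Frequency.
Variables (R : realType) (Z : finType) (z0 : Z).
Variables (Q : probability (outcome z0) R) (P : probability (sequences z0) R).
Hypothesis PQ : is_infinite_product Q P.
Variable A : forall n, n.-tuple Z -> n.-tuple rat.
Hypothesis cfA : conformity_measure A.

Lemma measurable_cylinder (s : seq Z) :
  measurable (cylinder s : set (sequences z0)).
Proof. by apply: sub_sigma_algebra; exists s. Qed.

(** Real-valued cylinder probabilities; a product over the entries is exchangeable, as [excess_hits]
    requires. *)
Let W (s : seq Z) : R := \prod_(z <- s) fine (Q [set z]).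

Lemma cylinderE s : P (cylinder s) = (W s)%:E.
Proof.
rewrite PQ /W -prodEFin; apply: eq_bigr => z _.
by rewrite fineK // fin_num_measure.
Qed.

Lemma sum_weight n : \sum_(t : n.-tuple Z) W t = 1.
Proof.
elim: n => [|n IHn].
  rewrite (bigD1 [tuple]) //= big1 => [|t /eqP[]]; last exact: tuple0.
  by rewrite /W big_nil addr0.
rewrite (sum_tuple_rcons n W).
under eq_bigr do under eq_bigr do rewrite /W -cats1 big_cat big_seq1.
under eq_bigr do rewrite -mulr_suml IHn mul1r.
exact: sum_outcome.
Qed.

Definition excess k n : set (sequences z0) :=
  [set w | (n.+1 < (hits A k (mkseq w n)).+1 * 2 ^ k)%N].

(** The event depends on the first [n] data only, hence is a finite union of cylinders: measurable,
    with probability at most a sum of weights. *)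
Lemma excessE k n : excess k n =
  \big[setU/set0]_(t : n.-tuple Z | (n.+1 < (hits A k t).+1 * 2 ^ k)%N) cylinder t.
Proof.
rewrite -(bigcup_pred [pred t : n.-tuple Z | (n.+1 < (hits A k t).+1 * 2 ^ k)%N]).
apply/seteqP; split => w.
  move=> exc; exists [tuple of mkseq w n] => //.
  by rewrite /cylinder /= size_tuple.
by case=> t /= exc; rewrite /cylinder /= size_tuple => wt; rewrite /excess /= wt.
Qed.

(** Borel-Cantelli: the probabilities are dominated by a geometric series with sum
    [a / (1 - rho)]. *)
Lemma excess_negligible k : P.-negligible (lim_sup_set (excess k)).
Proof.
have mcyl n (t : n.-tuple Z) := measurable_cylinder t.
have mE n : measurable (excess k n).
  by rewrite excessE; apply: bigsetU_measurable.
apply/negligibleP.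
  by apply: bigcap_measurable => // n _; apply: bigcup_measurable.
apply: lim_sup_set_cvg0 => //.
have [a [rho [a0 rho0 rho1 excle]]] := excess_hits R cfA k.
have PE n : (P (excess k n) <= (a * rho ^+ n)%:E)%E.
  rewrite excessE; apply: (le_trans (measure_bigsetU_le _ _ _ _)) => //.
  rewrite (eq_bigr _ (fun (t : n.-tuple Z) _ => cylinderE t)) sumEFin lee_fin.
  rewrite -[leRHS]mulr1 -(sum_weight n); apply: excle.
    by move=> s; apply: prodr_ge0 => z _; apply: fine_ge0.
  by move=> s t pst; apply: perm_big.
apply: (@le_lt_trans _ _ (a / (1 - rho))%:E); last exact: ltry.
apply: lime_le; first by apply: is_cvg_nneseries.
apply: nearW => n; apply: (@le_trans _ _ (\sum_(0 <= i < n) (a * rho ^+ i)%:E)%E).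
  by apply: lee_sum => i _; apply: PE.
rewrite sumEFin lee_fin -[leLHS]/(series (geometric a rho) n).
have rho_lt1 : 0 < 1 - rho by rewrite subr_gt0.
rewrite geometric_seriesE ?lt_eqF //= ler_pdivlMr ?divfK ?gt_eqF //.
by rewrite ler_piMr // gerBl exprn_ge0.
Qed.

(** A countable union of null sets is null, so one exceptional set serves all [k], and through them
    the uncountably many significance levels. *)
Lemma ae_few_hits : {ae P, forall w : sequences z0,
  forall k, \forall n \near \oo, ((hits A k (mkseq w n)).+1 * 2 ^ k <= n.+1)%N}.
Proof.
apply: (negligibleS _ (negligible_bigcup excess_negligible)) => w /= few.
apply: contrapT => rare; apply: few => k.
have /existsNP[n /existsNP[_ nexc]] : ~ lim_sup_set (excess k) w.
  by move=> infk; apply: rare; exists k.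
exists n => // l nl; rewrite leqNgt; apply/negP => exc; apply: nexc.
by exists l.
Qed.

End Frequency.
End AlmostSure.

(** * From the frequency bounds to the inclusion of prediction sets *)

Lemma near_forall_ltn (P : nat -> nat -> Prop) N :
  (forall k, \forall l \near \oo, P k l) ->
  \forall l \near \oo, forall k, k < N -> P k l.
Proof.
move=> nearP; elim: N => [|N IHN]; first exact: nearW.
apply: filterS2 IHN (nearP N) => l ltP PN k.
by rewrite ltnS leq_eqVlt => /predU1P[->|/ltP].
Qed.

Lemma last_rank_tuple (Z : finType) (A : forall n, n.-tuple Z -> n.-tuple rat)
    n (t : n.+1.-tuple Z) :
  last_rank A t =
  #|[pred i : 'I_n.+1 | (tnth (A n.+1 t) i <= tnth (A n.+1 t) ord_max)%R]|.
Proof.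
rewrite /last_rank scores_tuple -sum1_card -sum1_count big_tuple.
apply: eq_bigl => i; rewrite inE [tnth _ ord_max](tnth_nth 0%R) /=.
by rewrite -nth_last size_tuple.
Qed.

Lemma p_valueE (R : realType) (X : finType)
    (A : forall n, n.-tuple (X * bool) -> n.-tuple rat) (s : situation X) y :
  p_value R A s y =
  ((last_rank A (extend s y))%:R / (size s.1).+1%:R)%R.
Proof.
rewrite /p_value; congr (_%:R / _)%R.
exact/esym/(last_rank_tuple A [tuple of rcons (in_tuple s.1) (s.2, y)]).
Qed.

Lemma le_inv_pow2_floor_log (R : realType) (eps : R) n : (0 < eps)%R ->
  Num.floor (- (ln eps / ln 2))%R = Posz n -> (eps <= 2 ^- n)%R.
Proof.
move=> eps0 fn; have ln2 : (0 < ln 2 :> R)%R by rewrite ln_gt0 // ltr1n.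
have := Num.Theory.floor_le (- (ln eps / ln 2))%R; rewrite fn -mulNr.
rewrite ler_pdivlMr // lerNr => le_ln.
rewrite -ler_ln ?posrE ?invr_gt0 ?exprn_gt0 //.
by rewrite lnV ?posrE ?exprn_gt0 // lnXn // -[(ln 2 *+ n)%R]mulr_natl.
Qed.

Local Open Scope classical_set_scope.
Local Open Scope ring_scope.

Theorem theorem19 (R : realType) (X : {fset bitseq})
    (D : nat -> set (seq (X * bool)))
    (A : forall n, n.-tuple (X * bool) -> n.-tuple rat) :
  universal_prediction_system D ->
  conformity_measure A ->
  computable_measure A ->
  exists2 c : nat, (0 < c)%N &
    forall (z0 : X * bool)
      (Q : probability (outcome z0) R) (P : probability (sequences z0) R),
      is_infinite_product Q P ->
      {ae P, forall w : sequences z0, forall eps : R, 0 < eps < 1 ->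
        \forall l \near \oo,
          let s : situation X := (mkseq w l, (w l).1) in
          prediction_set D (Num.floor (- (ln eps / ln 2)) - c%:Z) s
            `<=` conformal_predictor A eps s}.
Proof.
move=> [_ univD] cfA cA.
have [c _ subD] := univD _ (conformal_system_spec cA).
(* [c] comes from universality; the extra 1 pays for the threshold [2^-(m+1)] used in the [m]-th
   set. *)
exists c.+1 => // z0 Q P PQ.
apply: filterS (ae_few_hits PQ cfA) => w few eps /andP[eps0 _].
set M := Num.floor _.
(* For a fixed [eps] only finitely many frequencies are tested, so they are all small from some [l]
   on. *)
apply: filterS (near_forall_ltn `|M| few) => l {}few y.
rewrite /prediction_set /conformal_predictor /=.
(* By contraposition: a label with p-value at most [eps] gives an extended sequence in the level
   set, trivially so at a negative level. *)
case EM : (M - c.+1%:Z) => [m|m] nD; rewrite ltNge; apply/negP => p_le;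
  apply: nD; last exact: I.
have {}EM : M = (m + c).+1%:Z by rewrite -addnS PoszD -EM subrK.
apply: (subD m); apply/andP; split.
  rewrite /hit /extend size_rcons size_mkseq.
  have := le_trans p_le (le_inv_pow2_floor_log eps0 EM).
  rewrite p_valueE size_mkseq ler_pdivrMr ?ltr0n // mulrC ler_pdivlMr ?exprn_gt0 //.
  by rewrite -natrX -natrM ler_nat.
apply/allP => k; rewrite mem_iota add0n => /andP[_ km].
rewrite /extend size_rcons size_mkseq hits_rcons.
apply: leq_trans (few k _); last by rewrite EM.
(* The appended datum adds at most one hit, which the successor in [few] absorbs. *)
by case: hit; rewrite ?addn1 ?addn0 leq_mul2r ?leqnn ?leqnSn orbT.
Qed.
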